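(* Let $G$ be a (finite, simple) graph with $mad(G)<\frac{14}{5}$. Then $ch_3^d(G)\le 7$.
   Context: For a graph $G$ and an integer $r\ge 1$, an $r$-dynamic coloring of $G$ is a proper vertex coloring $\phi$ such that for every vertex $v$, the neighborhood $N_G(v)$ contains at least $\min\{r,\deg_G(v)\}$ distinct colors. Given a list assignment $L$, $G$ is $r$-dynamically $L$-colorable if it has an $r$-dynamic coloring $\phi$ with $\phi(v)\in L(v)$ for all $v$. The list $r$-dynamic chromatic number $ch_r^d(G)$ is the least $k$ such that $G$ is $r$-dynamically $L$-colorable for every list assignment $L$ with $|L(v)|\ge k$ for all $v$. The maximum average degree $mad(G)$ is the maximum of $2|E(H)|/|V(H)|$ over all subgraphs $H$ of $G$ with at least one vertex. *)

(* Defs.v *)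
From HB Require Import structures.
From mathcomp Require Import all_boot all_order all_algebra finmap.
From mathcomp Require Import boolp.

Set Implicit Arguments.
Unset Strict Implicit.
Unset Printing Implicit Defensive.

Import Order.TTheory GRing.Theory Num.Theory.
Local Open Scope fset_scope.

Record sgraph := SGraph {
  vertex :> finType;
  adj : rel vertex;
  adj_sym : symmetric adj;
  adj_irr : irreflexive adj }.

Definition nbhd (G : sgraph) (v : G) : {set G} := [set w | adj v w].

Definition deg (G : sgraph) (v : G) : nat := #|nbhd v|.

Definition edges (G : sgraph) : {set {set G}} :=
  [set A : {set G} | [exists x, exists y, adj x y && (A == [set x; y])]].

(* A subgraph is a pair (vertex set, edge set). *)
Definition is_subgraph (G : sgraph) (H : {set G} * {set {set G}}) : bool :=
  (H.2 \subset edges G) && [forall A in H.2, A \subset H.1].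

(* All the averages are nonnegative, so the initial value 0 of the iterated
   maximum only matters for the graph without vertices, where mad is 0. *)
Definition mad (G : sgraph) : rat :=
  \big[Order.max/0%R]_(H : {set G} * {set {set G}} |
                       is_subgraph H && (H.1 != set0))
    ((2 * #|H.2|)%:R / #|H.1|%:R)%R.

Definition proper_coloring (G : sgraph) (C : eqType) (phi : G -> C) : Prop :=
  forall x y : G, adj x y -> phi x != phi y.

Definition dynamic_coloring (r : nat) (G : sgraph) (C : choiceType)
    (phi : G -> C) : Prop :=
  proper_coloring phi /\
  forall v : G, minn r (deg v) <= #|` [fset phi w | w in nbhd v] |.

Definition dyn_L_colorable (r : nat) (G : sgraph) (C : choiceType)
    (L : G -> {fset C}) : Prop :=
  exists phi : G -> C,
    dynamic_coloring r phi /\ forall v : G, phi v \in L v.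

Definition dyn_choosable (r : nat) (G : sgraph) (k : nat) : Prop :=
  forall (C : choiceType) (L : G -> {fset C}),
    (forall v : G, k <= #|` L v |) -> dyn_L_colorable r L.

Lemma injective_choice (T : finType) (C : choiceType) (L : T -> {fset C}) :
  (forall v, #|T| <= #|` L v |) ->
  exists2 phi : T -> C, injective phi & forall v, phi v \in L v.
Proof.
move=> hL.
have [v0 _ | T0] := pickP (@predT T); last first.
  have ab (x : T) : False by have := T0 x.
  by exists (fun x => match ab x with end) => x; case: (ab x).
have [c0 _] : exists c, c \in L v0.
  have : 0 < #|` L v0 |.
    by apply: leq_trans (hL v0); apply/card_gt0P; exists v0.
  by rewrite cardfs_gt0 => /fset0Pn.
suff [phi hi hm] : exists2 phi : T -> C,
    {in enum T &, injective phi} & {in enum T, forall v, phi v \in L v}.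
  exists phi => [x y|v]; last by apply: hm; rewrite mem_enum.
  by apply: hi; rewrite mem_enum.
have : uniq (enum T) by exact: enum_uniq.
have : size (enum T) <= #|T| by rewrite -cardE.
elim: (enum T) => [|a s IH] /= hs hu; first by exists (fun=> c0).
have /andP[ha us] := hu.
have [phi hi hm] := IH (ltnW hs) us.
have [c cL cN] : exists2 c, c \in L a & c \notin [seq phi x | x <- s].
  apply/hasP; apply: contraLR hs => /hasPn hN.
  rewrite -ltnNge ltnS; apply: leq_trans (hL a) _.
  rewrite -(size_map phi s); apply: uniq_leq_size; first exact: fset_uniq.
  by move=> c /hN; rewrite negbK.
have sa x : x \in s -> (x == a) = false.
  by move=> xs; apply/negP => /eqP xa; rewrite -xa xs in ha.
have nc x : x \in s -> phi x <> c.
  by move=> xs xc; move: cN; rewrite -xc map_f.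
exists (fun x => if x == a then c else phi x) => [x y|x].
  rewrite !inE => /predU1P[->|xs] /predU1P[->|ys]; rewrite ?eqxx ?sa //.
  - by move=> /esym /nc; case.
  - by move=> /nc; case.
  - exact: hi.
by rewrite inE => /predU1P[->|xs]; rewrite ?eqxx ?sa //; apply: hm.
Qed.

Lemma dyn_choosable_card (r : nat) (G : sgraph) : dyn_choosable r G #|G|.
Proof.
move=> C L /injective_choice[phi phiI phiL]; exists phi; split=> //; split.
  by move=> x y; apply: contraTneq => /phiI ->; rewrite adj_irr.
by move=> v; rewrite card_imfset //= -cardE geq_minr.
Qed.

Lemma dyn_choosable_ex (r : nat) (G : sgraph) :
  exists k, `[< dyn_choosable r G k >].
Proof. by exists #|G|; apply/asboolP/dyn_choosable_card. Qed.

Definition list_dyn_chrom (r : nat) (G : sgraph) : nat :=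
  ex_minn (dyn_choosable_ex r G).

(* Main.v *)
Require Import Defs.
From mathcomp Require Import all_boot all_order all_algebra.
From mathcomp Require Import finmap boolp zify.

Set Implicit Arguments.
Unset Strict Implicit.
Unset Printing Implicit Defensive.

Import Order.TTheory GRing.Theory Num.Theory.

(** Choose for every vertex [v] a set [T v] of [min (3, deg v)] neighbours, and
    let the conflict graph consist of the edges of [G] together with a clique on
    each [T v]; its proper colorings are 3-dynamic colorings of [G].  The
    conflict graph is 6-degenerate, hence 7-choosable.  Indeed, let [W] be a
    nonempty set in which every vertex has at least 7 conflicts, let [X] be the
    set of the [x] outside [W] with [#|T x :&: W| >= 2], and let [F] be [G[W]]
    together with the edges from each [x] in [X] to [T x :&: W].  Discharging on
    [F] from the initial charge [10 deg_F - 28] contradicts [mad G < 14/5]: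
    every vertex of [W] sends 4 to each neighbour of degree 2 and 1 to each
    neighbour in [U], the set of the vertices of [W] of degree 3 that have a
    neighbour of degree 2. *)

(** * Counting lemmas for finite sums and relations *)

Section FiniteSums.
Variable T : finType.
Implicit Types A B : {set T}.

Lemma card_bigcup_leq_sum A (F : T -> {set T}) :
  #|\bigcup_(i in A) F i| <= \sum_(i in A) #|F i|.
Proof.
elim/big_rec2: _ => [|i n B _ leBn]; first by rewrite cards0.
by apply: leq_trans (leq_card_setU _ _) _; rewrite leq_add2l.
Qed.

Lemma sum_mem_card A B : \sum_(y in A) (y \in B : nat) = #|A :&: B|.
Proof.
rewrite -sum1_card (eq_bigl _ _ (fun y => in_setI y A B)) big_mkcondr /=.
by apply: eq_bigr => y _; case: (y \in B).
Qed.

Lemma sum_card_neighbors_sym (f : rel T) A B : symmetric f ->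
  \sum_(a in A) #|[set y | f a y] :&: B|
    = \sum_(b in B) #|[set y | f b y] :&: A|.
Proof.
move=> fC; transitivity (\sum_(a in A) \sum_(b in B) (f a b : nat)).
  apply: eq_bigr => a _; rewrite setIC -sum_mem_card.
  by apply: eq_bigr => b _; rewrite inE.
rewrite exchange_big; apply: eq_bigr => b _; rewrite setIC -sum_mem_card.
by apply: eq_bigr => a _; rewrite inE fC.
Qed.

(** Only the ordered pairs [(x, y)] and [(y, x)] map to the set [[set x; y]]. *)
Lemma sum_degree_leq_pairs (f : rel T) :
  \sum_x #|[set y | f x y]| <=
    2 * #|[set A : {set T} | [exists x, exists y, f x y && (A == [set x; y])]]|.
Proof.
set E := finset _.
have -> : \sum_x #|[set y | f x y]| = \sum_(p : T * T | f p.1 p.2) 1.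
  rewrite -(pair_big_dep xpredT f (fun _ _ => 1)) /=.
  by apply: eq_bigr => x _; rewrite sum1dep_card.
rewrite (partition_big (fun p => [set p.1; p.2]) (mem E)) /=; last first.
  move=> [x y] fxy; rewrite inE; apply/existsP; exists x.
  by apply/existsP; exists y; rewrite fxy /=.
rewrite mulnC -sum_nat_const; apply: leq_sum => A.
rewrite inE => /existsP[x /existsP[y /andP[_ /eqP ->]]]; rewrite sum1dep_card.
apply: (@leq_trans #|[set (x, y); (y, x)]|); last by rewrite cards2; case: eqP.
apply: subset_leq_card; apply/subsetP => -[a b].
rewrite !inE /= => /andP[_ /eqP e].
have : a \in [set x; y] by rewrite -e !inE eqxx.
have : b \in [set x; y] by rewrite -e !inE eqxx orbT.
have : x \in [set a; b] by rewrite e !inE eqxx.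
have : y \in [set a; b] by rewrite e !inE eqxx orbT.
rewrite !inE !xpair_eqE.
by do 4![case/orP => /eqP ?]; subst; rewrite ?eqxx ?orbT.
Qed.

End FiniteSums.

(** * Greedy list coloring of degenerate graphs *)

Lemma degenerate_list_coloring (T : finType) (h : rel T) (C : choiceType)
    (L : T -> {fset C}) (k : nat) :
  symmetric h -> irreflexive h -> (forall v, k < #|` L v |) ->
  (forall W : {set T}, W != set0 ->
     exists2 w, w \in W & #|[set y in W | h w y]| <= k) ->
  exists2 phi : T -> C, (forall v, phi v \in L v)
    & forall x y, h x y -> phi x != phi y.
Proof.
move=> hC h0 hL hdeg.
suff [phi phiL phiP] : exists2 phi : T -> C, (forall v, phi v \in L v)
    & {in [set: T] &, forall x y, h x y -> phi x != phi y}.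
  by exists phi => // x y; apply: phiP; rewrite inE.
have [n] := ubnP #|[set: T]|; elim: n [set: T] => // n IHn W ltWn.
have [->|/hdeg[w wW degw]] := eqVneq W set0.
  (* Even for empty [W] a total [phi] is needed; the lists are nonempty, having more than [k]
     elements. *)
  have L0 v : exists c, c \in L v.
    by apply/fset0Pn; rewrite -cardfs_gt0 (leq_ltn_trans _ (hL v)).
  exists (fun v => xchoose (L0 v)) => [v|x y]; first exact: xchooseP.
  by rewrite inE.
have [|phi phiL phiP] := IHn (W :\ w); first by rewrite (cardsD1 w) wW in ltWn.
(* The neighbours of [w] in [W] block at most [k] colors, fewer than [L w] offers. *)
have [c cL cN] : exists2 c, c \in L w
    & c \notin [seq phi y | y in [set y in W | h w y]].
  apply/hasP; apply: contraLR (hL w) => /hasPn hN.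
  rewrite -leqNgt; apply: leq_trans degw.
  rewrite -(size_image phi); apply: uniq_leq_size; first exact: fset_uniq.
  by move=> c /hN; rewrite negbK.
have nc y : y \in W -> h w y -> phi y != c.
  by move=> yW hwy; apply: contraNneq cN => <-; rewrite image_f // inE yW.
exists (fun x => if x == w then c else phi x) => [v|x y xW yW hxy].
  by case: eqP => [->|].
case: (eqVneq x w) hxy => [->|xw]; case: (eqVneq y w) => [->|yw] hxy.
- by rewrite h0 in hxy.
- by rewrite eq_sym nc.
- by rewrite nc // hC.
- by apply: phiP => //; rewrite !inE ?xw ?yw.
Qed.

(** * The conflict graph *)

Section ConflictGraph.
Variables (G : sgraph) (T : G -> {set G}).
Hypothesis T_sub : forall v, T v \subset nbhd v.
Hypothesis T_card : forall v, #|T v| <= 3.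

Definition conflict : rel G := fun w y =>
  (y != w) && (adj w y || [exists v, (w \in T v) && (y \in T v)]).

Lemma conflict_sym : symmetric conflict.
Proof.
move=> x y; rewrite /conflict eq_sym adj_sym.
by under eq_existsb do rewrite andbC.
Qed.

Lemma conflict_irr : irreflexive conflict.
Proof. by move=> x; rewrite /conflict eqxx. Qed.

Lemma T_adj v y : y \in T v -> adj v y.
Proof. by move/(subsetP (T_sub v)); rewrite inE. Qed.

(** * A dense subgraph from a set with many conflicts *)

Section DenseSubgraph.
Variable W : {set G}.
Hypothesis W_conflicts : forall w, w \in W ->
  7 <= #|[set y in W | conflict w y]|.

Let t v := T v :&: W.
Let X := [set x | (x \notin W) && (1 < #|t x|)].
(* [f] is the adjacency relation of the graph [F] of the header. *)
Let f : rel G := fun u v =>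
  [|| [&& u \in W, v \in W & adj u v], (u \in X) && (v \in t u)
    | (v \in X) && (u \in t v)].
Let N v := [set y | f v y].
(** [X2] and [X3] collect the vertices of [X] of degree 2 and 3 in [F]. Vertices of [W] turn out to
    have degree at least 3, so [X2] contains all those of degree 2. *)
Let X2 := [set x in X | #|t x| == 2].
Let X3 := X :\: X2.
Let U := [set u in W | (#|N u| == 3) && (0 < #|N u :&: X2|)].

Let f_sym : symmetric f.
Proof.
by move=> u v; rewrite /f adj_sym andbCA; congr orb; rewrite orbC.
Qed.

Let f_adj u v : f u v -> adj u v.
Proof.
by case/or3P => [/and3P[]//|/andP[_]|/andP[_]]; rewrite inE => /andP[/T_adj];
  rewrite // adj_sym.
Qed.

Let t_card v : #|t v| <= 3.
Proof. by apply: leq_trans (T_card v); rewrite subset_leq_card ?subsetIl. Qed.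

Let X_notW x : x \in X -> x \in W = false.
Proof. by rewrite inE => /andP[/negbTE]. Qed.

Let N_X x : x \in X -> N x = t x.
Proof.
move=> xX; apply/setP => y; rewrite in_set /f (X_notW xX) xX /=.
by rewrite [x \in t y]in_setI (X_notW xX) !andbF orbF.
Qed.

Let card_N_X2 x : x \in X2 -> #|N x| = 2.
Proof. by rewrite inE => /andP[/N_X -> /eqP]. Qed.

Let card_N_X3 x : x \in X3 -> #|N x| = 3.
Proof.
rewrite in_setD => /andP[+ xX]; rewrite in_set xX (N_X xX) /=.
by have := t_card x; move: xX; rewrite in_set => /andP[_]; lia.
Qed.

Let N_X_sub x : x \in X -> N x \subset W.
Proof. by move=> /N_X ->; rewrite subsetIr. Qed.

Let N_W_split w : w \in W ->
  #|N w| = #|N w :&: W| + #|N w :&: X2| + #|N w :&: X3|.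
Proof.
move=> wW; rewrite -(cardsID W) -addnA; congr addn.
rewrite -(cardsID X2); congr addn; apply: eq_card => y;
  rewrite !inE /f wW /= !inE wW /=; case: (y \in W); case: (adj w y);
  case: (1 < #|t y|); case: (w \in T y); by rewrite ?andbT ?andbF.
Qed.

(* The conflicts of [w] in [W] that are due to its [F]-neighbour [y]. *)
Let K w y :=
  if y \in W then y |: (if w \in T y then t y :\ w else set0) else t y :\ w.

(** If [w] and [y] conflict through [v], then [v] is an [F]-neighbour of [w]: by adjacency when [v]
    is in [W], and otherwise because [w] and [y] both lie in [t v], which puts [v] in [X]. *)
Let conflicts_sub w : w \in W ->
  [set y in W | conflict w y] \subset \bigcup_(y in N w) K w y.
Proof.
move=> wW; apply/subsetP => y; rewrite inE => /and3P[yW yw].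
case/orP => [awy|/existsP[v /andP[wv yv]]].
  apply/bigcupP; exists y; first by rewrite inE /f wW yW awy.
  by rewrite /K yW !inE eqxx.
have yt : y \in t v :\ w by rewrite !inE yw yv yW.
apply/bigcupP; exists v; last first.
  by rewrite /K wv; case: ifP => // _; rewrite inE yt orbT.
have avw := T_adj wv; rewrite inE /f wW /=; case: (boolP (v \in W)) => vW /=.
  by rewrite adj_sym avw.
apply/orP; right; rewrite !inE vW wv wW /= andbT.
have : [set w; y] \subset t v.
  by apply/subsetP => z; rewrite !inE => /orP[]/eqP->; rewrite ?wv ?wW ?yv ?yW.
by move/subset_leq_card; rewrite cards2 eq_sym yw => ->.
Qed.

(** One of the three [F]-neighbours of [u] is in [X2], so at most two are in [W], and [t u] lies
    among these. *)
Let t_card_U u : u \in U -> #|t u| <= 2.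
Proof.
rewrite inE => /and3P[uW /eqP d3 k0].
apply: (@leq_trans #|N u :&: W|); last by have := N_W_split uW; lia.
apply/subset_leq_card/subsetP => y; rewrite !inE /f uW.
by case/andP => /T_adj -> ->.
Qed.

(** A neighbour accounts for at most 3 conflicts in general, 2 if it is in [U] or [X3], and 1 if it
    is in [X2]. *)
Let card_K w y : w \in W -> y \in N w ->
  #|K w y| + 2 * (y \in X2) + (y \in U) + (y \in X3) <= 3.
Proof.
move=> wW yN; rewrite /K; case: (boolP (y \in W)) => yW.
  have -> : y \in X2 = false by rewrite !inE yW.
  have -> : y \in X3 = false by rewrite !inE yW andbF.
  rewrite muln0 !addn0; case: ifP => wT; last first.
    by rewrite setU0 cards1; case: (y \in U).
  have := cardsD1 w (t y); rewrite inE wT wW /= => e.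
  have [+ _] := leq_card_setU [set y] (t y :\ w); rewrite cards1.
  have := t_card y; case: (boolP (y \in U)) => [/t_card_U|_] /=; lia.
have yU : y \in U = false by rewrite inE (negbTE yW).
have /andP[yX wt] : (y \in X) && (w \in t y).
  move: yN; rewrite inE /f (negbTE yW) andbF /= => /orP[/andP[wX]|//].
  by rewrite inE (negbTE yW) andbF.
have := cardsD1 w (t y); rewrite wt yU /=.
rewrite /X3 in_setD (in_set _ y) yX /= !andbT.
by have := t_card y; case: eqP => /=; lia.
Qed.

Let degree_bound w : w \in W ->
  7 + 2 * #|N w :&: X2| + #|N w :&: U| + #|N w :&: X3| <= 3 * #|N w|.
Proof.
move=> wW; rewrite [3 * _]mulnC -sum_nat_const.
have := leq_sum (index_enum G) (fun y => @card_K w y wW); apply: leq_trans.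
rewrite 3!big_split /= -big_distrr /= !sum_mem_card !leq_add2r.
apply: leq_trans (W_conflicts wW) _.
apply: leq_trans (subset_leq_card (conflicts_sub wW)) _.
exact: card_bigcup_leq_sum.
Qed.

Let final_charge w : w \in W ->
  28 + 4 * #|N w :&: X2| + #|N w :&: U| <=
    10 * #|N w| + (if w \in U then #|N w :&: W| else 0).
Proof.
move=> wW; have := degree_bound wW; have := N_W_split wW.
rewrite (in_set _ w) wW /=.
have : #|N w :&: U| <= #|N w :&: W|.
  by apply/subset_leq_card/setIS/subsetP => u; rewrite inE => /andP[].
(* For [w] in [U], [degree_bound] forces one neighbour in [X2], two in [W] and none in [U], so
   equality holds: 28 + 4 = 30 + 2. From degree 4 on, twice [degree_bound] suffices. *)
by case: eqP => /= [d3|d3]; case: (posnP #|N w :&: X2|) => k0 /=; lia.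
Qed.

(** Summing [final_charge] over [W], the charge sent to [U] cancels the charge received there, and
    each vertex of [X2] gets 4 from both its neighbours. *)
Let sum_degree_W : 28 * #|W| + 8 * #|X2| <= 10 * \sum_(w in W) #|N w|.
Proof.
have : \sum_(w in W) 28 + 4 * \sum_(w in W) #|N w :&: X2|
         + \sum_(w in W) #|N w :&: U|
    <= 10 * \sum_(w in W) #|N w|
         + \sum_(w in W) (if w \in U then #|N w :&: W| else 0).
  by rewrite !big_distrr -!big_split; apply: leq_sum => w /final_charge.
rewrite sum_nat_const (sum_card_neighbors_sym W X2 f_sym).
rewrite (sum_card_neighbors_sym W U f_sym).
have -> : \sum_(x in X2) #|N x :&: W| = #|X2| * 2.
  rewrite -sum_nat_const; apply: eq_bigr => x xX2; rewrite -(card_N_X2 xX2).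
  by rewrite (setIidPl _) // N_X_sub //; move: xX2; rewrite inE => /andP[].
have -> : \sum_(w in W) (if w \in U then #|N w :&: W| else 0)
    = \sum_(u in U) #|N u :&: W|.
  rewrite -big_mkcondr; apply: eq_bigl => u /=.
  by rewrite andb_idl // inE => /andP[].
move: (\sum_(w in U) _) (\sum_(w in W) _); lia.
Qed.

(** The 8 units received by a vertex of [X2] cover its deficit 28 - 20, and a vertex of [X3] starts
    with surplus 2. So the degrees in [F] average at least 28/10. *)
Lemma dense_subgraph : W != set0 ->
  exists2 H : {set G} * {set {set G}}, is_subgraph H && (H.1 != set0)
    & 14 * #|H.1| <= 10 * #|H.2|.
Proof.
move=> W0.
pose E := [set A : {set G} | [exists x, exists y, f x y && (A == [set x; y])]].
exists (W :|: X, E) => /=.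
  rewrite setU_eq0 (negbTE W0) andbT; apply/andP; split => /=.
    apply/subsetP => A; rewrite !inE => /existsP[x /existsP[y /andP[fxy eA]]].
    by apply/existsP; exists x; apply/existsP; exists y; rewrite f_adj.
  apply/forallP => A; apply/implyP; rewrite inE.
  move=> /existsP[x /existsP[y /andP[fxy /eqP->]]].
  suff fW u v : f u v -> u \in W :|: X.
    have xV := fW _ _ fxy; rewrite f_sym in fxy; have yV := fW _ _ fxy.
    by apply/subsetP => z; rewrite in_set2 => /orP[]/eqP->.
  rewrite in_setU; case/or3P => [/and3P[->]//|/andP[-> _]|]; first exact: orbT.
  by case/andP => _ /setIP[_ ->].
have sumX : \sum_(x in X) #|N x| = 2 * #|X2| + 3 * #|X3|.
  rewrite (bigID (mem X2)) /= ![_ * #|_|]mulnC -!sum_nat_const; congr addn.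
    rewrite (eq_bigl (mem X2)); last by move=> x; rewrite /= !inE andbA andbb.
    by apply: eq_bigr => x /card_N_X2.
  rewrite (eq_bigl (mem X3)); last by move=> x; rewrite /= in_setD andbC.
  by apply: eq_bigr => x /card_N_X3.
have cardX : #|X| = #|X2| + #|X3|.
  rewrite -(cardsID X2) (setIidPr _) //.
  by apply/subsetP => x; rewrite inE => /andP[].
have cardV : #|W :|: X| = #|W| + #|X|.
  rewrite cardsU (_ : W :&: X = set0) ?cards0 ?subn0 //.
  by apply/setP => x; rewrite !inE andbA andbN.
have sumV : \sum_(w in W) #|N w| + \sum_(x in X) #|N x| <= \sum_x #|N x|.
  rewrite [leqRHS](bigID (mem W)) /= leq_add2l [leqRHS](bigID (mem X)) /=.
  apply: leq_trans (leq_addr _ _).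
  rewrite (eq_bigl (fun x => (x \notin W) && (x \in X))) //.
  by move=> x; case: (boolP (x \in X)) => [/X_notW ->|]; rewrite ?andbF.
have sumE : \sum_x #|N x| <= 2 * #|E| := sum_degree_leq_pairs f.
move: sumX cardX cardV sumV sumE sum_degree_W.
set a := \sum_(w in W) _; set b := \sum_(x in X) _; set c := \sum_x _.
move: a b c #|_| #|_| #|_| #|_| #|_| #|_|; lia.
Qed.

End DenseSubgraph.

Lemma conflict_degenerate (W : {set G}) : (mad G < 14%:R / 5%:R)%R ->
  W != set0 -> exists2 w, w \in W & #|[set y in W | conflict w y]| <= 6.
Proof.
move=> madG W0; apply/exists_inP; apply: contraT => /exists_inPn hW.
have [|H Hsub Hdense] := @dense_subgraph W _ W0.
  by move=> w wW; rewrite ltnNge hW.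
have {madG}: ((2 * #|H.2|)%:R / #|H.1|%:R < 14%:R / 5%:R :> rat)%R.
  apply: le_lt_trans madG.
  exact: (bigmax_sup H).
have H0 : 0 < #|H.1| by rewrite card_gt0; case/andP: Hsub.
rewrite ltr_pdivrMr ?ltr0n // mulrAC ltr_pdivlMr ?ltr0n // -!natrM ltr_nat.
by move: Hdense; lia.
Qed.

End ConflictGraph.

(** * From colorings of the conflict graph to 3-dynamic colorings *)

Theorem theorem1p4 (G : sgraph) :
  (mad G < 14%:R / 5%:R)%R -> (list_dyn_chrom 3 G <= 7)%N.
Proof.
move=> madG; rewrite /list_dyn_chrom; case: ex_minnP => m _; apply.
apply/asboolP => C L hL.
pose T (v : G) := [set x in take 3 (enum (nbhd v))].
have T_sub v : T v \subset nbhd v.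
  by apply/subsetP => x; rewrite inE => /mem_take; rewrite mem_enum.
have T_card v : #|T v| = minn 3 (deg v).
  rewrite cardsE (card_uniqP _) ?take_uniq ?enum_uniq //.
  by rewrite size_take_min -cardE.
have T_le3 v : #|T v| <= 3 by rewrite T_card geq_minl.
have [phi phiL phiP] := degenerate_list_coloring (conflict_sym T)
  (conflict_irr T) hL (fun W => conflict_degenerate T_sub T_le3 madG).
exists phi; split=> //; split=> [x y axy|v].
  apply: phiP; rewrite /conflict axy andbT.
  by apply: contraTneq axy => ->; rewrite adj_irr.
rewrite -T_card.
(* [T v] is a clique of the conflict graph, so its vertices alone show [minn 3 (deg v)] colors. *)
have phiI : {in T v &, injective phi}.
  move=> x y xT yT; apply: contra_eq => xy; apply: phiP.
  rewrite /conflict eq_sym xy.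
  by apply/orP; right; apply/existsP; exists v; rewrite xT.
have -> : #|T v| = #|` [fset phi w | w in T v]%fset|.
  by rewrite card_in_imfset //= -cardE.
apply: fsubset_leq_card; apply/fsubsetP => c /imfsetP[x /= xT ->].
by apply: in_imfset; apply: (subsetP (T_sub v)).
Qed.
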